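(* Let $H$ be a real Hilbert space, let $\Theta$ be a finite-dimensional real Hilbert space, let $\Phi\in C^2(\Theta;H)$, $F:H\to H$, $\tau>0$ and $\varepsilon\ge 0$. Assume that there is $\ell\in\mathbb{R}$ such that $$\langle u-\widetilde u,\,F(u)-F(\widetilde u)\rangle_H\le \ell\,\|u-\widetilde u\|_H^2\qquad\text{for all }u,\widetilde u\in H.$$ Let $u(t)$ be a sufficiently smooth solution of $\dot u(t)=F(u(t))$ on $[0,T]$, let $(\theta(t),v(t))$ be a sufficiently smooth solution on $[0,T]$ of $$\dot\theta=v,\qquad \tau^2\dot v+\bigl(J(\theta)^*J(\theta)+\varepsilon^2I\bigr)v=J(\theta)^*f(\theta),$$ and set $\hat u(t)=\Phi(\theta(t))$. Then, for every $t\in[0,T]$, $$\|\hat u(t)-u(t)\|_H\le e^{\ell t}\,\|\hat u(0)-u(0)\|_H+\int_0^t e^{\ell(t-s)}\bigl(\delta_\varepsilon(s)^2+\rho_\varepsilon(s)^2\bigr)^{1/2}\,ds.$$ In particular, if $\hat u(0)=u(0)$, then $$\|\hat u(t)-u(t)\|_H\le \int_0^t e^{\ell(t-s)}\bigl(\delta_\varepsilon(s)^2+\rho_\varepsilon(s)^2\bigr)^{1/2}\,ds.$$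
   Context: For $\theta\in\Theta$, $J(\theta):\Theta\to H$ is the linear map $J(\theta)w:=D\Phi(\theta)[w]$, $J(\theta)^*:H\to\Theta$ is its adjoint with respect to the inner products of $H$ and $\Theta$, and $f(\theta):=F(\Phi(\theta))$. For $\varepsilon>0$, $\bar v_\varepsilon(t)$ denotes the unique minimizer over $w\in\Theta$ of $\frac12\|J(\theta(t))w-f(\theta(t))\|_H^2+\frac{\varepsilon^2}{2}\|w\|_\Theta^2$. For $\varepsilon=0$, $\bar v_0(t)$ denotes any minimizer over $w\in\Theta$ of $\frac12\|J(\theta(t))w-f(\theta(t))\|_H^2$; the vector $J(\theta(t))\bar v_0(t)$ does not depend on the choice of minimizer. Set $\dot{\bar u}_\varepsilon(t):=J(\theta(t))\bar v_\varepsilon(t)$ (this is notation for an element of $H$). The projection defect $\delta_\varepsilon(t)\ge 0$ and relaxation defect $\rho_\varepsilon(t)\ge 0$ are defined by $$\delta_\varepsilon(t)^2:=\|\dot{\bar u}_\varepsilon(t)-f(\theta(t))\|_H^2+\varepsilon^2\|\bar v_\varepsilon(t)\|_\Theta^2,$$ $$\rho_\varepsilon(t)^2:=\|J(\theta(t))(v(t)-\bar v_\varepsilon(t))\|_H^2+\varepsilon^2\|v(t)-\bar v_\varepsilon(t)\|_\Theta^2,$$ where the terms with prefactor $\varepsilon^2$ vanish if $\varepsilon=0$. ''Sufficiently smooth'' means here that $u$, $\theta$ and $v$ are continuously differentiable and that $t\mapsto F(\hat u(t))$ is continuous. *)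

(* Defs.v *)
From HB Require Import structures.
From mathcomp Require Import all_boot all_order all_algebra.
From mathcomp Require Import all_classical all_reals all_analysis.
From mathcomp Require Import ring lra.

Set Implicit Arguments.
Unset Strict Implicit.
Unset Printing Implicit Defensive.

Import Order.TTheory GRing.Theory Num.Theory.
Import numFieldNormedType.Exports.

Local Open Scope classical_set_scope.
Local Open Scope ring_scope.

(* [{dot V for idfun}] is the type of symmetric positive definite bilinear
   forms on [V]. *)
HB.mixin Record NormedModule_isInnerProduct (R : realType) (V : Type)
    & NormedModule R V := {
  inner : {dot V for idfun};
  sqr_norm_inner : forall x : V, `|x| ^+ 2 = inner x x
}.

#[short(type="innerProductType")]
HB.structure Definition InnerProduct (R : realType) :=
  {V of NormedModule R V & NormedModule_isInnerProduct R V}.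

#[short(type="hilbertType")]
HB.structure Definition Hilbert (R : realType) :=
  {V of CompleteNormedModule R V & NormedModule_isInnerProduct R V}.

#[short(type="finDimHilbertType")]
HB.structure Definition FinDimHilbert (R : realType) :=
  {V of Hilbert R V & Vector R V}.

Section InnerTheory.
Context {R : realType} {V : innerProductType R}.
Lemma inner_sym (x y : V) : inner x y = inner y x.
Proof. by rewrite hermitian_subproof expr0 mul1r. Qed.
Lemma inner_linl (a : R) (x y z : V) : inner (a *: x + y) z = a * inner x z + inner y z.
Proof. by rewrite linearDl linearZl. Qed.
Lemma inner_linr (a : R) (x y z : V) : inner z (a *: x + y) = a * inner z x + inner z y.
Proof. by rewrite inner_sym inner_linl ![inner _ z]inner_sym. Qed.
Lemma inner0l (x : V) : inner 0 x = 0.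
Proof. by have := inner_linl 1 0 0 x; rewrite scaler0 addr0; lra. Qed.
Lemma inner_ge0 (x : V) : 0 <= inner x x.
Proof. by rewrite -sqr_norm_inner sqr_ge0. Qed.
End InnerTheory.

Section FormRepresentation.
Context {R : realType} {V : vectType R}.
(* Finite-dimensional Riesz representation for a positive semidefinite form. *)
Lemma form_repr (B : V -> V -> R) (L : V -> R) :
  (forall a x y z, B (a *: x + y) z = a * B x z + B y z) ->
  (forall x y, B x y = B y x) -> (forall x, 0 <= B x x) ->
  (forall a x y, L (a *: x + y) = a * L x + L y) ->
  (forall x, B x x = 0 -> L x = 0) ->
  exists w, forall x, B w x = L x.
Proof.
move=> Bl Bs B0.
have Br a x y z : B z (a *: x + y) = a * B z x + B z y.
  by rewrite Bs Bl ![B _ z]Bs.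
have Bdeg x y : B x x = 0 -> B x y = 0.
  move=> xx0; apply/eqP; apply: contraT => nz.
  have := B0 ((- (B y y + 1) / (2 * B x y)) *: x + y).
  rewrite Bl !Br xx0 (Bs y x).
  set c := _ / _; have -> : B y y = - c * (2 * B x y) - 1.
    by rewrite /c; field.
  lra.
have key (s : seq V) : forall L : V -> R,
  (forall a x y, L (a *: x + y) = a * L x + L y) ->
  (forall x, B x x = 0 -> L x = 0) ->
  exists2 w, w \in span s & forall x, x \in span s -> B w x = L x.
  elim: s => [|x s IH] {}L Ll L0.
    exists 0; rewrite ?mem0v// => x; rewrite span_nil memv0 => /eqP ->.
    have B00 : B 0 0 = 0.
      by have := Bl 1 0 0 0; rewrite scaler0 addr0; lra.
    by rewrite B00 L0.
  have [w0 w0s w0P] := IH L Ll L0.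
  have [y ys yP] := IH (B x) (fun a u v => Br a u v x)
    (fun u u0 => etrans (Bs _ _) (Bdeg _ _ u0)).
  pose z := (-1) *: y + x.
  have zs u : u \in span s -> B z u = 0.
    by move=> us; rewrite /z Bl yP//; lra.
  have sub u : u \in span s -> u \in span (x :: s).
    by move=> us; rewrite span_cons -[u]add0r memv_add// mem0v.
  have zin : z \in span (x :: s).
    by apply: rpredD; [rewrite rpredZ// sub|rewrite memv_span// mem_head].
  pose c := if B z z == 0 then 0 else (L z - B w0 z) / B z z.
  exists (c *: z + w0); first by rewrite rpredD ?rpredZ// sub.
  move=> u; rewrite span_cons => /memv_addP[_ /vlineP[k ->] [u' u's ->]].
  have -> : x = 1 *: y + z by rewrite scale1r /z addrA scaleN1r subrr add0r.
  have cz : c * B z z + B w0 z = L z.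
    rewrite /c; case: eqP => [zz|/eqP zz]; last by field.
    by rewrite (L0 _ zz) (Bs w0) (Bdeg _ w0 zz) mul0r addr0.
  clearbody z c.
rewrite !(Bl, Br, Ll) !(zs _ u's) !(zs _ ys) !(w0P _ u's) !(w0P _ ys) -cz; ring.
move=> Ll L0; have [w _ wP] := key (vbasis fullv) L Ll L0.
by exists w => x; apply: wP; rewrite (span_basis (vbasisP _)) memvf.
Qed.
End FormRepresentation.

Section Adjoint.
Context {R : realType} {V W : innerProductType R}.

(* The element [z] is unique when it exists, and it exists for linear [A] when
   [V] is finite dimensional (see [adjointP]); the value is 0 otherwise. *)
Definition adjoint (A : V -> W) (h : W) : V :=
  xget 0 [set z : V | forall w : V, inner (A w) h = inner w z].

End Adjoint.

Section AdjointTheory.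
Context {R : realType} {H : innerProductType R} {Theta : finDimHilbertType R}.

Lemma adjointP (A : {linear Theta -> H}) (h : H) (w : Theta) :
  inner (A w) h = inner w (adjoint A h).
Proof.
suff ex : [set z | forall w, inner (A w) h = inner w z] !=set0.
  rewrite /adjoint; exact: (@xgetPex _ 0 [set z | forall w, inner (A w) h = inner w z] ex w).
have [||||x|z zP] := @form_repr R Theta (fun x y => inner x y) (fun w => inner (A w) h).
- exact: inner_linl.
- exact: inner_sym.
- exact: inner_ge0.
- by move=> a x y; rewrite linearP inner_linl.
- rewrite -sqr_norm_inner => /eqP; rewrite sqrf_eq0 normr_eq0 => /eqP ->.
  by rewrite linear0 inner0l.
by exists z => w' /=; rewrite -zP inner_sym.
Qed.

End AdjointTheory.

Section C2.
Context {R : realType} {V W : normedModType R}.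

(* Continuous second Frechet derivative, spelled out with the operator norms of
   L(V, W) and L(V, L(V, W)): [D2 x] is a bounded bilinear map, it is the
   Frechet derivative at [x] of [y |-> 'd Phi y], and [x |-> D2 x] is
   continuous. *)
Definition C2 (Phi : V -> W) : Prop :=
  (forall x, differentiable Phi x) /\
  exists D2 : V -> {bilinear V -> V -> W},
    [/\ forall x, exists M : R, forall h w,
          `|D2 x h w| <= M * `|h| * `|w|,
        forall x (e : R), 0 < e -> \forall y \near x, forall w,
          `|'d Phi y w - 'd Phi x w - D2 x (y - x) w| <= e * `|y - x| * `|w|
      & forall x (e : R), 0 < e -> \forall y \near x, forall h w,
          `|D2 y h w - D2 x h w| <= e * `|h| * `|w|].

End C2.

Section DerivativeOn.
Context {R : realType} {V : normedModType R}.
Implicit Types (A : set R) (g : R -> V).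

(* Derivatives relative to [A]: one-sided at the endpoints of an interval. *)
Definition diff_quot g (t s : R) : V := (s - t)^-1 *: (g s - g t).

Definition derivable_on A g : Prop :=
  forall t, A t -> cvg (diff_quot g t @ within A t^').

Definition deriv_on A g (t : R) : V := lim (diff_quot g t @ within A t^').

Definition C1_on A g : Prop :=
  derivable_on A g /\ {within A, continuous (deriv_on A g)}.

End DerivativeOn.

Section Defects.
Context {R : realType} {H : hilbertType R} {Theta : finDimHilbertType R}.
Implicit Types (J : Theta -> H) (h : H) (eps : R) (v vbar w : Theta).

Definition tikhonov J h eps w : R :=
  2^-1 * `|J w - h| ^+ 2 + eps ^+ 2 / 2 * `|w| ^+ 2.

Definition is_tikhonov_minimizer J h eps vbar : Prop :=
  forall w, tikhonov J h eps vbar <= tikhonov J h eps w.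

Definition projection_defect J h eps vbar : R :=
  Num.sqrt (`|J vbar - h| ^+ 2 + eps ^+ 2 * `|vbar| ^+ 2).

Definition relaxation_defect J eps v vbar : R :=
  Num.sqrt (`|J (v - vbar)| ^+ 2 + eps ^+ 2 * `|v - vbar| ^+ 2).

Lemma tikhonov_minimizer_exists (A : {linear Theta -> H}) (h : H) (eps : R) :
  exists w, is_tikhonov_minimizer A h eps w.
Proof.
pose B (x y : Theta) := inner (A x) (A y) + eps ^+ 2 * inner x y.
have e0 : 0 <= eps ^+ 2 by rewrite sqr_ge0.
have B0 x : 0 <= B x x.
  apply: addr_ge0; first exact: inner_ge0.
  by apply: mulr_ge0 => //; exact: inner_ge0.
have Bl a x y z : B (a *: x + y) z = a * B x z + B y z.
  by rewrite /B linearP !inner_linl; ring.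
have Bs x y : B x y = B y x by rewrite /B inner_sym (inner_sym x).
have [|x|w wP] := form_repr Bl Bs B0 (L := fun w => inner (A w) h).
- by move=> a x y; rewrite linearP inner_linl.
- move=> /eqP; rewrite /B paddr_eq0; last 2 first.
  + exact: inner_ge0.
  + by apply: mulr_ge0 => //; exact: inner_ge0.
  move=> /andP[+ _].
  by rewrite -sqr_norm_inner sqrf_eq0 normr_eq0 => /eqP ->; rewrite inner0l.
exists w => w'; rewrite /tikhonov -subr_ge0.
have -> : w' = 1 *: w + (w' - w) by rewrite scale1r addrC subrK.
move: (w' - w) => d.
have E k : k - h = (-1) *: h + k by rewrite scaleN1r addrC.
have := wP d; have := B0 d; rewrite !sqr_norm_inner linearP !E.
rewrite !(inner_linl, inner_linr) /B (inner_sym h (A w)) (inner_sym h (A d)).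
rewrite (inner_sym d w) (inner_sym (A d) (A w)).
nra.
Qed.

End Defects.

(* Main.v *)
Require Import Defs.
From mathcomp Require Import all_boot all_order all_algebra.
From mathcomp Require Import all_classical all_reals all_analysis.
From mathcomp Require Import ring lra.

Import Order.TTheory GRing.Theory Num.Theory.
Import numFieldNormedType.Exports.

Local Open Scope classical_set_scope.
Local Open Scope ring_scope.

(** Since [vbar] minimizes the regularized least-squares functional of [J], the
    residual of [vbar] is orthogonal to the range of [w |-> (J w, eps w)], so
    Pythagoras ([defect_pythagoras]) collapses the two defects into one residual
    that no longer mentions [vbar]:
      delta^2 + rho^2 = |J v - f|^2 + eps^2 |v|^2.
    Write [sigma] for the square root of the right-hand side. Two things follow.
    First, [sigma] bounds [|J v - f|], which is how far the velocity [J v] of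
    [uhat] is from [F uhat]. Second, [sigma] is continuous in time, because
    [Phi] is C2 ([cvg_diff_C2]), although [vbar] itself may jump when
    [eps = 0]; this is what allows the fundamental theorem of calculus to be
    applied to the integral of the bound.

    The error [e = uhat - u] then has [e' = (J v - F uhat) + (F uhat - F u)],
    and Cauchy-Schwarz with the one-sided Lipschitz condition gives
      <e, e'> <= ell |e|^2 + sigma |e|.
    A Gronwall argument ([gronwall_inner]) turns this into the claimed bound.
    The norm need not be differentiable where [e] vanishes, so the comparison is
    made for the square [p] of [exp(- ell t) |e|], through the smooth function
    [sqrt (p + eta^2)], and [eta] is sent to zero at the end ([sqrt_growth]).
    Derivatives relative to [[0, T]] are two-sided at interior times
    ([deriv_on_interior]); from the endpoints only the continuity they imply
    enters ([derivable_on_continuous]). *)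

Set Implicit Arguments.
Unset Strict Implicit.
Unset Printing Implicit Defensive.

(** * Inner products *)

(** Expressing [inner] by norms makes its joint continuity a consequence of that
    of the norm. *)
Lemma inner_polarization (R : realType) (V : innerProductType R) (x y : V) :
  inner x y = 4^-1 * (`|x + y| * `|x + y| - `|x - y| * `|x - y|).
Proof.
rewrite -!expr2.
have -> : x + y = 1 *: x + y by rewrite scale1r.
have -> : x - y = (-1) *: y + x by rewrite scaleN1r addrC.
rewrite !sqr_norm_inner !(inner_linl, inner_linr) (inner_sym y x).
by field.
Qed.

Lemma cvg_inner (R : realType) (V : innerProductType R) (T : Type)
    (F : set_system T) (a b : T -> V) (x y : V) : Filter F ->
  a @ F --> x -> b @ F --> y -> inner (a s) (b s) @[s --> F] --> inner x y.
Proof.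
move=> FF ax bY; rewrite inner_polarization.
under eq_fun do rewrite inner_polarization.
apply: cvgM; first exact: cvg_cst.
by apply: cvgB; apply: cvgM; apply: cvg_norm; do [exact: cvgD|exact: cvgB].
Qed.

(** Cauchy-Schwarz, from the nonnegative square of [|y| x - |x| y]. *)
Lemma inner_le_norm (R : realType) (V : innerProductType R) (x y : V) :
  inner x y <= `|x| * `|y|.
Proof.
have := inner_ge0 (`|y| *: x + (- `|x|) *: y).
have -> : (- `|x|) *: y = (- `|x|) *: y + 0 by rewrite addr0.
rewrite !(inner_linl, inner_linr) !inner0l ![inner _ 0]inner_sym !inner0l.
rewrite (inner_sym y x) -!sqr_norm_inner.
have [->|x0] := eqVneq x 0; first by rewrite inner0l normr0 mul0r.
have [->|y0] := eqVneq y 0; first by rewrite inner_sym inner0l normr0 mulr0.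
rewrite -normr_gt0 in x0; rewrite -normr_gt0 in y0.
have xy := mulr_gt0 x0 y0.
move=> H; rewrite -(ler_pM2l xy); nra.
Qed.

(** * Derivatives *)

(** By symmetry of [inner], [|a|^2 - |b|^2 = <a - b, a + b>], so the difference
    quotient of the squared norm is the inner product of the one of [w] with
    [w (t + h) + w t]. *)
Lemma is_derive_sqr_norm (R : realType) (V : innerProductType R)
    (w : R -> V) (t : R) (dw : V) :
  is_derive t (1 : R) w dw ->
  is_derive t (1 : R) (fun s => `|w s| ^+ 2) (2 * inner (w t) dw).
Proof.
move=> [wd wE].
have wc : {for t, continuous w}.
  by apply: differentiable_continuous; apply/derivable1_diffP.
suff C : h^-1 *: (((fun s => `|w s| ^+ 2) \o shift t) (h *: (1 : R)) - `|w t| ^+ 2)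
    @[h --> (0 : R)^'] --> 2 * inner (w t) dw.
  by split; [apply/cvg_ex; eexists; exact: C|apply: cvg_lim].
have -> : 2 * inner (w t) dw = inner dw (w t + w t).
  rewrite -{2}[w t]scale1r inner_linr inner_sym; ring.
have E : forall h : R,
  h^-1 *: (((fun s => `|w s| ^+ 2) \o shift t) (h *: (1 : R)) - `|w t| ^+ 2) =
  inner (h^-1 *: ((w \o shift t) (h *: (1 : R)) - w t)) (w (h + t) + w t).
  move=> h /=; rewrite [h *: 1]mulr1.
  set a := w (h + t); set b := w t.
  have -> : a - b = (-1) *: b + a by rewrite scaleN1r addrC.
  have -> : a + b = 1 *: b + a by rewrite scale1r addrC.
  rewrite -[h^-1 *: (_ + a)]addr0 !(inner_linl, inner_linr) !inner0l.
  rewrite !sqr_norm_inner (inner_sym b a) /GRing.scale /=; ring.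
under eq_fun do rewrite E.
apply: cvg_inner.
  by rewrite -wE; exact: wd.
apply: cvgD; last exact: cvg_cst.
have : (fun h : R => h + t) @ (0 : R)^' --> t.
  rewrite -{2}[t]add0r; apply: cvgD; last exact: cvg_cst.
  exact: cvg_within.
move=> C; exact: (cvg_comp _ _ C wc).
Qed.

Lemma deriv_on_cvg (R : realType) (V : normedModType R) (A : set R)
    (g : R -> V) (t : R) :
  derivable_on A g -> A t ->
  diff_quot g t @ within A t^' --> deriv_on A g t.
Proof. by move=> gd At; exact: gd. Qed.

(** A punctured neighbourhood of an interior point of [A] may be taken inside
    [A], so the relative derivative is the usual one. *)
Lemma deriv_on_interior (R : realType) (V : normedModType R) (A : set R)
    (g : R -> V) (t : R) :
  derivable_on A g -> A° t -> is_derive t (1 : R) g (deriv_on A g t).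
Proof.
move=> gd At; have /(deriv_on_cvg gd) C := interior_subset At.
have C' : diff_quot g t s @[s --> t^'] --> deriv_on A g t.
  apply: cvg_trans C; apply: cvg_app => P.
  rewrite /within => nP.
  have AA : t^' A by apply: nbhs_dnbhs; exact: At.
  have nP' : t^' (fun x => A x -> P x) by exact: nP.
  by apply: filterS (filterI nP' AA) => x []; apply.
suff Cg : h^-1 *: ((g \o shift t) (h *: (1 : R)) - g t)
    @[h --> (0 : R)^'] --> deriv_on A g t.
  by split; [apply/cvg_ex; eexists; exact: Cg|apply: cvg_lim].
have E : forall h : R, h^-1 *: ((g \o shift t) (h *: (1 : R)) - g t) =
  diff_quot g t (h + t).
  by move=> h /=; rewrite /diff_quot [h *: 1]mulr1 addrK.
under eq_fun do rewrite E.
apply: (@cvg_comp _ _ _ (fun h : R => h + t) (diff_quot g t) _ _ _ _ C').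
move=> P; rewrite /= !nbhs_simpl /dnbhs /within /= => /nbhs_ballP[e e0 eP].
apply/nbhs_ballP; exists e => //= h; rewrite /ball /= sub0r normrN => he h0.
apply: eP; rewrite /ball /=; first by rewrite opprD addrCA subrr addr0 normrN.
by apply: contra_neq h0 => /eqP; rewrite -subr_eq0 addrK => /eqP.
Qed.

(** Near [t], [g s] is [(s - t)] times a convergent difference quotient, plus
    [g t]. *)
Lemma derivable_on_continuous (R : realType) (V : normedModType R) (A : set R)
    (g : R -> V) :
  derivable_on A g -> {within A, continuous g}.
Proof.
move=> gd; apply/subspace_continuousP => t At.
have C := deriv_on_cvg gd At.
have D : g s @[s --> within A t^'] --> g t.
  have -> : g t = 0 *: deriv_on A g t + g t by rewrite scale0r add0r.
  have E : within A t^' (fun s => (s - t) *: diff_quot g t s + g t = g s).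
    suff : t^' (fun s => A s -> (s - t) *: diff_quot g t s + g t = g s) by [].
    apply: filterS (nbhs_dnbhs_neq t) => s st _.
    by rewrite /diff_quot scalerA divff ?scale1r ?subrK// subr_eq0.
  apply: cvg_trans; first exact: (near_eq_cvg E).
  apply: cvgD; last exact: cvg_cst.
  apply: cvgZ C.
  rewrite -(subrr t); apply: cvgB; last exact: cvg_cst.
  exact: (cvg_trans (@cvg_within _ t^' _ A) (@nbhs_dnbhs _ t)).
move=> P nP; have DP : t^' (fun s => A s -> P (g s)) by exact: (D P nP).
suff : nbhs t (fun s => A s -> P (g s)) by [].
have DP' : nbhs t (fun s => s != t -> A s -> P (g s)) by exact: DP.
apply: filterS DP' => s H As.
by have [->|/H] := eqVneq s t; [exact: nbhs_singleton|apply].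
Qed.

Lemma is_derive_diff_comp (R : realType) (V W : normedModType R) (Phi : V -> W)
    (q : R -> V) (dq : V) (t : R) :
  differentiable Phi (q t) -> is_derive t (1 : R) q dq ->
  is_derive t (1 : R) (Phi \o q) ('d Phi (q t) dq).
Proof.
move=> Phid [/derivable1_diffP qd qE].
have cd : differentiable (Phi \o q) t by exact: differentiable_comp.
split; first exact/derivable1_diffP.
by rewrite deriveE// diff_comp// -qE deriveE.
Qed.

(** Existence of the second derivative at [q0] bounds the operator norm of
    ['d Phi y - 'd Phi q0] by a multiple of [|y - q0|] for [y] near [q0], so
    [('d Phi (q s) - 'd Phi q0) (v s)] tends to zero; what remains is the
    continuity of the fixed linear map ['d Phi q0]. *)
Lemma cvg_diff_C2 (R : realType) (V W : normedModType R) (Phi : V -> W)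
    (T : Type) (F : set_system T) (q : T -> V) (v : T -> V) (q0 v0 : V) :
  Filter F -> C2 Phi -> q @ F --> q0 -> v @ F --> v0 ->
  'd Phi (q s) (v s) @[s --> F] --> 'd Phi q0 v0.
Proof.
move=> FF [Phid [D2 [D2b D2d _]]] qq vv.
have Jc : 'd Phi q0 (v s) @[s --> F] --> 'd Phi q0 v0.
  apply: (cvg_comp _ _ vv); apply: diff_continuous; exact: Phid.
have [M MP] := D2b q0.
have -> : 'd Phi q0 v0 = 0 + 'd Phi q0 v0 by rewrite add0r.
have -> : (fun s => 'd Phi (q s) (v s)) =
  (fun s => ('d Phi (q s) (v s) - 'd Phi q0 (v s)) + 'd Phi q0 (v s)).
  by apply/funext => s; rewrite subrK.
apply: cvgD => //.
apply/norm_cvg0P.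
have near1 : \forall s \near F,
  `|'d Phi (q s) (v s) - 'd Phi q0 (v s)| <= (1 + M) * `|q s - q0| * `|v s|.
  have D : F (fun s => forall w, `|'d Phi (q s) w - 'd Phi q0 w - D2 q0 (q s - q0) w|
      <= 1 * `|q s - q0| * `|w|).
    exact: (qq _ (D2d q0 1 ltr01)).
  apply: filterS D => s /(_ (v s)) Ds.
  rewrite -[X in `|X|](subrK (D2 q0 (q s - q0) (v s))).
  apply: le_trans (ler_normD _ _) _.
  have := MP (q s - q0) (v s); lra.
have Z : (1 + M) * `|q s - q0| * `|v s| @[s --> F] --> 0.
  have -> : (0 : R) = (1 + M) * `|q0 - q0| * `|v0|.
    by rewrite subrr normr0 mulr0 mul0r.
  apply: cvgM; last exact: cvg_norm.
  apply: cvgM; first exact: cvg_cst.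
  by apply: cvg_norm; apply: cvgB => //; exact: cvg_cst.
apply: (squeeze_cvgr _ (cvg_cst 0) Z).
by apply: filterS near1 => s ->; rewrite normr_ge0.
Qed.

Lemma interior_itvcc (R : realType) (a b t : R) :
  a < t < b -> (`[a, b]%classic)° t.
Proof. by move=> tab; rewrite interior_itv_bnd. Qed.

(** * A Gronwall estimate *)

(** Formally [(sqrt p)' = dp / (2 sqrt p) <= sigma], but [sqrt] is singular
    where [p] vanishes. Adding [eta^2] under the root removes the singularity and
    keeps the inequality because [sigma] is nonnegative. *)
Lemma sqrt_growth (R : realType) (p dp sigma : R -> R) (T : R) :
  0 <= T ->
  {within `[0, T], continuous p} -> {within `[0, T], continuous sigma} ->
  (forall t, 0 <= p t) -> (forall t, 0 <= sigma t) ->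
  (forall t, 0 < t < T -> is_derive t (1 : R) p (dp t)) ->
  (forall t, 0 < t < T -> dp t <= 2 * sigma t * Num.sqrt (p t)) ->
  Num.sqrt (p T) <=
    Num.sqrt (p 0) + \int[lebesgue_measure]_(s in `[0, T]) sigma s.
Proof.
move=> T0 pC sC p0 s0 pD dpE.
have [->|Tn0] := eqVneq T 0; first by rewrite set_itv1 Rintegral_set1 addr0.
have {Tn0} Tgt0 : 0 < T by rewrite lt_neqAle eq_sym Tn0.
have sI : lebesgue_measure.-integrable `[0, T] (EFin \o sigma).
  by apply: continuous_compact_integrable => //; exact: segment_compact.
apply/ler_addgt0Pr => eta eta0.
pose I s := \int[lebesgue_measure]_(x in `[0, s]) sigma x.
pose q s := Num.sqrt (p s + eta ^+ 2) - I s.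
have pe0 s : 0 < p s + eta ^+ 2 by rewrite ltr_wpDl// exprn_gt0.
have qD t : 0 < t < T ->
    is_derive t (1 : R) q ((2 * Num.sqrt (p t + eta ^+ 2))^-1 * dp t - sigma t).
  move=> /andP[t0 tT].
  have sCt : {for t, continuous sigma}.
    by apply: (within_continuous_continuous _ sC) => //; rewrite in_itv/= t0.
  have [ID IE] := continuous_FTC1_closed tT sI t0 sCt.
  have DI : is_derive t (1 : R) I (sigma t) by split => //; rewrite -derive1E.
  have Dp : is_derive t (1 : R) p (dp t) by apply: pD; rewrite t0.
  have Dpe : is_derive t (1 : R) (fun s => p s + eta ^+ 2) (dp t).
    by rewrite -[dp t]addr0; apply: is_deriveD.
  have Ds := is_derive1_sqrt (pe0 t).
  (* [DI], and the chain rule applied to [Ds] and [Dpe], are found by instance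
     inference. *)
  apply: is_deriveB.
have qC : {within `[0, T], continuous q}.
  move=> x; apply: cvgB.
    apply: continuous_comp; last exact: sqrt_continuous.
    by apply: cvgD; [exact: pC|exact: cvg_cst].
  exact: parameterized_integral_continuous.
have H : q T <= q 0.
  apply: (@ler0_derive1_le_cc R q 0 T) => //; rewrite ?in_itv/= ?lexx ?T0//.
    by move=> t; rewrite in_itv /= => /qD[].
  move=> t; rewrite in_itv /= => tT; have [_ qE] := qD t tT.
  rewrite derive1E qE subr_le0 ler_pdivrMl ?mulr_gt0 ?sqrtr_gt0//.
  apply: (le_trans (dpE t tT)); rewrite mulrAC ler_wpM2r// ler_wpM2l//.
  by rewrite ler_sqrt ?lerDl ?sqr_ge0// ltW.
move: H; rewrite /q /I set_itv1 Rintegral_set1 subr0 => H.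
have pT : Num.sqrt (p T) <= Num.sqrt (p T + eta ^+ 2).
  by rewrite ler_sqrt ?lerDl ?sqr_ge0// ltW.
have p00 : Num.sqrt (p 0 + eta ^+ 2) <= Num.sqrt (p 0) + eta.
  rewrite -[leRHS]ger0_norm ?addr_ge0 ?sqrtr_ge0 ?(ltW eta0)//.
  rewrite -sqrtr_sqr ler_sqrt ?sqr_ge0// sqrrD sqr_sqrtr// lerD2r lerDl.
  by rewrite mulrn_wge0// mulr_ge0 ?sqrtr_ge0// ltW.
lra.
Qed.

(** With the integrating factor [E s = exp (- ell s)], the square of [E |e|]
    satisfies the hypotheses of [sqrt_growth] for the rate [E sigma]: the term
    in [ell] is cancelled by the derivative of [E^2]. *)
Lemma gronwall_inner (R : realType) (V : innerProductType R) (e de : R -> V)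
    (sigma : R -> R) (ell T : R) :
  0 <= T ->
  {within `[0, T], continuous e} -> {within `[0, T], continuous sigma} ->
  (forall t, 0 <= sigma t) ->
  (forall t, 0 < t < T -> is_derive t (1 : R) e (de t)) ->
  (forall t, 0 < t < T ->
     inner (e t) (de t) <= ell * `|e t| ^+ 2 + sigma t * `|e t|) ->
  `|e T| <= expR (ell * T) * `|e 0|
    + \int[lebesgue_measure]_(s in `[0, T]) (expR (ell * (T - s)) * sigma s).
Proof.
move=> T0 eC sC s0 eD deE.
pose E s := expR (- ell * s).
have E0 : E 0 = 1 by rewrite /E mulr0 expR0.
have EC : continuous E.
  move=> x; apply: (@continuous_comp _ _ _ (fun s => - ell * s) expR).
    by apply: cvgM; [exact: cvg_cst|exact: cvg_id].
  exact: continuous_expR.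
have EsC : {within `[0, T], continuous (fun s => E s * sigma s)}.
  by move=> x; apply: cvgM; [exact: (continuous_subspaceT EC)|exact: sC].
pose p s := (E s * `|e s|) ^+ 2.
have sqrtp s : Num.sqrt (p s) = E s * `|e s|.
  by rewrite sqrtr_sqr ger0_norm// mulr_ge0// expR_ge0.
have H : E T * `|e T| <= `|e 0| +
    \int[lebesgue_measure]_(s in `[0, T]) (E s * sigma s).
  have := @sqrt_growth R p
    (fun t => 2 * E t ^+ 2 * (inner (e t) (de t) - ell * `|e t| ^+ 2))
    (fun s => E s * sigma s) T.
  rewrite !sqrtp E0 mul1r; apply.
  - by [].
  - have C : {within `[0, T], continuous (fun s => E s * `|e s|)}.
      move=> y; apply: cvgM; first exact: (continuous_subspaceT EC).
      by apply: cvg_norm; exact: eC.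
    have -> : p = (fun s => (E s * `|e s|) * (E s * `|e s|)) by [].
    by move=> x; apply: cvgM; exact: C.
  - exact: EsC.
  - by move=> t; exact: sqr_ge0.
  - by move=> t; rewrite mulr_ge0 ?expR_ge0.
  - move=> t tT.
    have Dl : is_derive t (1 : R) (fun s => - ell * s) (- ell).
      by rewrite -[X in is_derive _ _ _ X]mulr1; apply: is_deriveZ.
    have De := is_derive_expR (- ell * t).
    have DE := is_derive1_comp De Dl.
    have Dn := is_derive_sqr_norm (eD t tT).
    have := is_deriveM (is_deriveM DE DE) Dn.
    have -> : (expR \o *%R (- ell)) * (expR \o *%R (- ell)) *
        (fun s => `|e s| ^+ 2) = p.
      by apply/funext => s; rewrite /p exprMn expr2.
    move/is_derive_eq; apply.
    rewrite /GRing.scale /= !mulrfctE /= -/(E t); ring.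
  - move=> t tT; rewrite sqrtp.
    have -> : 2 * (E t * sigma t) * (E t * `|e t|) =
      2 * E t ^+ 2 * (sigma t * `|e t|) by ring.
    rewrite ler_wpM2l ?mulr_ge0 ?sqr_ge0 ?expR_ge0//.
    have := deE t tT; lra.
have sI : lebesgue_measure.-integrable `[0, T] (EFin \o (fun s => E s * sigma s)).
  by apply: continuous_compact_integrable => //; exact: segment_compact.
rewrite [X in _ <= _ + X](_ : _ = expR (ell * T) *
    \int[lebesgue_measure]_(s in `[0, T]) (E s * sigma s)); last first.
  rewrite -RintegralZl//; apply: eq_Rintegral => s _.
  by rewrite mulrA /E -expRD mulrBr mulNr.
rewrite -mulrDr -ler_pdivrMl ?expR_gt0// -expRN.
by rewrite /E mulNr in H.
Qed.

(** * Defects of the regularized projection *)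

(** The normal equations: along the line [vbar + s d] the functional grows by a
    quadratic polynomial in [s], whose linear coefficient must vanish. *)
Lemma tikhonov_normal (R : realType) (H : hilbertType R)
    (Theta : finDimHilbertType R) (A : {linear Theta -> H}) (h : H) (eps : R)
    (vbar d : Theta) :
  is_tikhonov_minimizer A h eps vbar ->
  inner (A d) (A vbar - h) + eps ^+ 2 * inner d vbar = 0.
Proof.
move=> mn.
pose b := inner (A d) (A vbar - h) + eps ^+ 2 * inner d vbar; rewrite -/b.
set a := `|A d| ^+ 2 + eps ^+ 2 * `|d| ^+ 2.
have a0 : 0 <= a.
  apply: addr_ge0; first exact: exprn_ge0.
  by apply: mulr_ge0; [exact: sqr_ge0|exact: exprn_ge0].
have quad s : 0 <= s * b + s ^+ 2 / 2 * a.
  have := mn (s *: d + vbar); rewrite /tikhonov -subr_ge0.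
  rewrite linearP -(addrA (s *: _)) /a /b !sqr_norm_inner.
  move: (A d) (A vbar - h) => x y.
  rewrite !(inner_linl, inner_linr) (inner_sym y x) (inner_sym vbar d).
  by move/le_trans; apply; rewrite le_eqVlt; apply/orP; left; apply/eqP; field.
(* The exact minimizer of the quadratic is at [- b / a]; since [a] may be zero,
   [a + 1] is used, which still makes the value negative unless [b] is zero. *)
have q1 := quad (- b / (a + 1)).
have a1 : a + 1 != 0 by apply: lt0r_neq0; lra.
have E : - b / (a + 1) * b + (- b / (a + 1)) ^+ 2 / 2 * a =
  - ((b / (a + 1)) ^+ 2 * (a / 2 + 1)) by field.
rewrite E oppr_ge0 in q1.
have : (b / (a + 1)) ^+ 2 * (a / 2 + 1) == 0.
  by rewrite eq_le q1 mulr_ge0 ?sqr_ge0//; lra.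
rewrite mulf_eq0 sqrf_eq0 mulf_eq0 invr_eq0 (negPf a1) orbF.
by move=> /orP[/eqP//|/eqP K]; exfalso; lra.
Qed.

(** [A v - h] and [v] split as the residual of [vbar] plus the contribution of
    [v - vbar], and the cross terms are the normal equations at [v - vbar]. *)
Lemma defect_pythagoras (R : realType) (H : hilbertType R)
    (Theta : finDimHilbertType R) (A : {linear Theta -> H}) (h : H) (eps : R)
    (v vbar : Theta) :
  is_tikhonov_minimizer A h eps vbar ->
  projection_defect A h eps vbar ^+ 2 + relaxation_defect A eps v vbar ^+ 2
  = `|A v - h| ^+ 2 + eps ^+ 2 * `|v| ^+ 2.
Proof.
move=> mn; rewrite /projection_defect /relaxation_defect.
have nn (a b : R) : 0 <= a ^+ 2 + eps ^+ 2 * b ^+ 2.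
  by apply: addr_ge0; [|apply: mulr_ge0]; exact: sqr_ge0.
rewrite !sqr_sqrtr ?nn//.
have := tikhonov_normal (v - vbar) mn.
have -> : A v - h = 1 *: A (v - vbar) + (A vbar - h).
  by rewrite scale1r linearB addrA subrK.
have -> : `|v| = `|1 *: (v - vbar) + vbar| by rewrite scale1r subrK.
move: (A vbar - h) => y; move: (A (v - vbar)) => x; move: (v - vbar) => d.
rewrite !sqr_norm_inner !(inner_linl, inner_linr) (inner_sym y x) (inner_sym vbar d).
move=> K; lra.
Qed.

Unset Implicit Arguments.

(** * The error bound *)

Theorem theorem3p1 (R : realType) (H : hilbertType R)
    (Theta : finDimHilbertType R) (Phi : Theta -> H) (F : H -> H)
    (tau eps ell T : R)
    (u : R -> H) (theta v vbar : R -> Theta) :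
  let J (q : Theta) : Theta -> H := 'd Phi q in
  let f (q : Theta) : H := F (Phi q) in
  let uhat (t : R) : H := Phi (theta t) in
  let delta (t : R) : R :=
    projection_defect (J (theta t)) (f (theta t)) eps (vbar t) in
  let rho (t : R) : R :=
    relaxation_defect (J (theta t)) eps (v t) (vbar t) in
  C2 Phi -> 0 < tau -> 0 <= eps ->
  (forall x y : H, inner (x - y) (F x - F y) <= ell * `|x - y| ^+ 2) ->
  C1_on `[0, T] u -> C1_on `[0, T] theta -> C1_on `[0, T] v ->
  {within `[0, T], continuous (fun t => F (uhat t))} ->
  (forall t, 0 <= t <= T -> deriv_on `[0, T] u t = F (u t)) ->
  (forall t, 0 <= t <= T -> deriv_on `[0, T] theta t = v t) ->
  (forall t, 0 <= t <= T ->
     tau ^+ 2 *: deriv_on `[0, T] v t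
       + (adjoint (J (theta t)) (J (theta t) (v t)) + eps ^+ 2 *: v t)
     = adjoint (J (theta t)) (f (theta t))) ->
  (forall t, 0 <= t <= T ->
     is_tikhonov_minimizer (J (theta t)) (f (theta t)) eps (vbar t)) ->
  (forall t, 0 <= t <= T ->
     `|uhat t - u t| <= expR (ell * t) * `|uhat 0 - u 0|
       + \int[lebesgue_measure]_(s in `[0, t])
           (expR (ell * (t - s)) * Num.sqrt (delta s ^+ 2 + rho s ^+ 2))) /\
  (uhat 0 = u 0 ->
   forall t, 0 <= t <= T ->
     `|uhat t - u t| <=
       \int[lebesgue_measure]_(s in `[0, t])
         (expR (ell * (t - s)) * Num.sqrt (delta s ^+ 2 + rho s ^+ 2))).
Proof.
move=> J f uhat delta rho PhiC2 _ _ Fdis [uD _] [thD _] [vD _] FC uE thE _ mn.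
suff bound t : 0 <= t <= T ->
    `|uhat t - u t| <= expR (ell * t) * `|uhat 0 - u 0|
       + \int[lebesgue_measure]_(s in `[0, t])
           (expR (ell * (t - s)) * Num.sqrt (delta s ^+ 2 + rho s ^+ 2)).
  split=> // uhat0 t /bound.
  by rewrite uhat0 subrr normr0 mulr0 add0r.
move=> /andP[t0 tT].
have sub : `[0, t] `<=` `[0, T] by exact: subset_itvl.
have inT s : 0 < s < t -> 0 < s < T.
  by move=> /andP[-> st]; exact: lt_le_trans st tT.
have leT s : 0 < s < T -> 0 <= s <= T by move=> /andP[/ltW-> /ltW->].
pose sigma s := Num.sqrt (`|J (theta s) (v s) - f (theta s)| ^+ 2
  + eps ^+ 2 * `|v s| ^+ 2).
have thC := derivable_on_continuous thD.
have vC := derivable_on_continuous vD.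
have uC := derivable_on_continuous uD.
have JC : {within `[0, T], continuous (fun s => J (theta s) (v s))}.
  by move=> s; apply: cvg_diff_C2 => //; [exact: thC|exact: vC].
have sC : {within `[0, T], continuous sigma}.
  move=> s; apply: continuous_comp; last exact: sqrt_continuous.
  have NC : {within `[0, T], continuous (fun s => `|J (theta s) (v s) - f (theta s)|)}.
    by move=> x; apply: cvg_norm; apply: cvgB; [exact: JC|exact: FC].
  have nvC : {within `[0, T], continuous (fun s => `|v s|)}.
    by move=> x; apply: cvg_norm; exact: vC.
  apply: cvgD; first by apply: cvgM; exact: NC.
  by apply: cvgM; [exact: cvg_cst|apply: cvgM; exact: nvC].
have eC : {within `[0, T], continuous (fun s => uhat s - u s)}.
  move=> s; apply: cvgB; last exact: uC.
  apply: continuous_comp; first exact: thC.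
  by apply: differentiable_continuous; exact: PhiC2.1.
rewrite [X in _ <= _ + X](_ : _ =
    \int[lebesgue_measure]_(s in `[0, t]) (expR (ell * (t - s)) * sigma s)); last first.
  apply: eq_Rintegral => s /set_mem/sub; rewrite /= in_itv /= => sT.
  by rewrite /delta /rho /sigma defect_pythagoras//; exact: mn.
apply: (@gronwall_inner R H (fun s => uhat s - u s)
  (fun s => J (theta s) (v s) - F (u s)) sigma ell t) => //.
- exact: continuous_subspaceW sub eC.
- exact: continuous_subspaceW sub sC.
- by move=> s; exact: sqrtr_ge0.
- move=> s /inT sT; have sI := interior_itvcc sT.
  have := deriv_on_interior uD sI; rewrite uE ?leT// => du.
  have := deriv_on_interior thD sI; rewrite thE ?leT// => dth.
  apply: is_deriveB; exact: (is_derive_diff_comp (PhiC2.1 _) dth).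
move=> s _.
have -> : J (theta s) (v s) - F (u s) =
  1 *: (J (theta s) (v s) - f (theta s)) + (F (uhat s) - F (u s)).
  by rewrite scale1r addrA subrK.
rewrite inner_linr mul1r addrC lerD// mulrC.
apply: le_trans (inner_le_norm _ _) _; rewrite ler_wpM2l//.
rewrite -[leLHS]ger0_norm// -sqrtr_sqr ler_wsqrtr// lerDl.
by apply: mulr_ge0; exact: sqr_ge0.
Qed.
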